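(* Let $\Gamma$ be a simplicial complex and let $\mathbf{m}$ be a squarefree monomial. Suppose that $\Gamma_{\mathbf{m}}$ has a well ordered facet cover of cardinality $i$. Then $b_{i,\mathbf{m}}(S/\mathcal{F}(\Gamma))\neq 0$.
   Context: A simplicial complex $\Gamma$ on a finite vertex set $V(\Gamma)$ is a set of subsets of $V(\Gamma)$ (called faces) such that $\{v\}\in\Gamma$ for every $v\in V(\Gamma)$ and such that every subset of a face is a face. Its facets are its inclusion-maximal faces. The simplicial complex whose facets are $F_1,\ldots,F_q$ is denoted $\langle F_1,\ldots,F_q\rangle$. Here $\Gamma$ has vertices $x_1,\ldots,x_n$, $\Bbbk$ is a fixed field, and $S=\Bbbk[x_1,\ldots,x_n]$. The facet ideal of $\Gamma$ is the ideal $\mathcal{F}(\Gamma)=(x_{i_1}\cdots x_{i_k} \mid \{x_{i_1},\ldots,x_{i_k}\}\text{ is a facet of }\Gamma)$ of $S$. For a set $A$ of vertices of $\Gamma$, the induced subcollection $\Gamma_A$ is the simplicial complex $\langle F \mid F \text{ a facet of } \Gamma,\ F\subseteq A\rangle$. A squarefree monomial $x_{i_1}\cdots x_{i_k}$ is used interchangeably with the set $\{x_{i_1},\ldots,x_{i_k}\}$, so $\Gamma_{\mathbf{m}}$ denotes $\Gamma_A$ with $A$ the set of variables dividing $\mathbf{m}$. A set $D$ of facets of a simplicial complex $\Delta$ is a facet cover of $\Delta$ if every vertex of $\Delta$ belongs to some element of $D$; it is minimal if no proper subset of it is a facet cover of $\Delta$. A sequence $F_1,\ldots,F_k$ of facets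 of $\Delta$ is a well ordered facet cover of $\Delta$ (of cardinality $k$) if $\{F_1,\ldots,F_k\}$ is a minimal facet cover of $\Delta$ and for every facet $H\notin\{F_1,\ldots,F_k\}$ of $\Delta$ there exists $\ell\leq k-1$ such that $F_\ell\subseteq H\cup F_{\ell+1}\cup F_{\ell+2}\cup\cdots\cup F_k$. $b_{i,\mathbf{m}}(S/I)$ denotes the $i$th multigraded Betti number of $S/I$ in multidegree $\mathbf{m}$, i.e. the rank of the summand generated in multidegree $\mathbf{m}$ in homological degree $i$ of the minimal multigraded free resolution of $S/I$ (with $S$ in homological degree $0$).
   Formalization: It is additionally assumed that the vertices of Γ_m are exactly the variables dividing m; without this the claim fails, e.g. Γ = ⟨{x1,x2},{x3,x4}⟩, m = x1x2x3, i = 1, where b_{1,m} = 0. *)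

(* Defs.v *)
From HB Require Import structures.
From mathcomp Require Import all_boot all_order all_algebra.
From mathcomp Require Export mpoly.

Set Implicit Arguments.
Unset Strict Implicit.
Unset Printing Implicit Defensive.

Import GRing.Theory.
Local Open Scope ring_scope.

(* The void complex (no faces) and the complex {set0} are both allowed. *)
Record scomplex (T : finType) := SComplex {
  vertices : {set T};
  faces : {set {set T}};
  face_sub : forall F, F \in faces -> F \subset vertices;
  vertex_face : forall v, v \in vertices -> [set v] \in faces;
  face_down : forall F G : {set T}, F \in faces -> G \subset F -> G \in faces
}.

Definition facets (T : finType) (K : scomplex T) : {set {set T}} :=
  [set F | maxset [pred G | G \in faces K] F].

Definition gen_faces (T : finType) (Fs : {set {set T}}) : {set {set T}} :=
  [set G : {set T} | [exists F in Fs, G \subset F]].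

Fact gen_face_sub (T : finType) (Fs : {set {set T}}) (F : {set T}) :
  F \in gen_faces Fs -> F \subset cover Fs.
Proof.
rewrite inE => /exists_inP[G GFs sFG].
exact: subset_trans sFG (bigcup_sup G GFs).
Qed.

Fact gen_vertex_face (T : finType) (Fs : {set {set T}}) (v : T) :
  v \in cover Fs -> [set v] \in gen_faces Fs.
Proof.
case/bigcupP=> F FFs vF; rewrite inE; apply/exists_inP.
by exists F; rewrite ?sub1set.
Qed.

Fact gen_face_down (T : finType) (Fs : {set {set T}}) (F G : {set T}) :
  F \in gen_faces Fs -> G \subset F -> G \in gen_faces Fs.
Proof.
rewrite !inE => /exists_inP[H HFs sFH] sGF; apply/exists_inP.
by exists H => //; exact: subset_trans sGF sFH.
Qed.

(* <F_1, ..., F_q>; its vertices are the points lying in some F_j. *)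
Definition gen_complex (T : finType) (Fs : {set {set T}}) : scomplex T :=
  SComplex (@gen_face_sub T Fs) (@gen_vertex_face T Fs) (@gen_face_down T Fs).

Definition induced (T : finType) (K : scomplex T) (A : {set T}) : scomplex T :=
  gen_complex [set F in facets K | F \subset A].

Definition facet_cover (T : finType) (K : scomplex T) : pred {set {set T}} :=
  fun D => (D \subset facets K) && (vertices K \subset cover D).

Definition minimal_facet_cover (T : finType) (K : scomplex T)
    (D : {set {set T}}) : bool :=
  minset (facet_cover K) D.

(* The sequence is indexed from 0, so "l <= k - 1" becomes l.+1 < k.  Its     *)
(* terms are distinct, the cover {F_1, ..., F_k} being of cardinality k.      *)
Definition well_ordered_facet_cover (T : finType) (K : scomplex T) (k : nat)
    (F : 'I_k -> {set T}) : Prop :=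
  [/\ injective F,
      minimal_facet_cover K [set F j | j : 'I_k] &
      forall H : {set T}, H \in facets K -> H \notin [set F j | j : 'I_k] ->
        exists l : 'I_k, (l.+1 < k)%N /\
          F l \subset H :|: \bigcup_(j : 'I_k | (l < j)%N) F j].

Definition squarefree (n : nat) (m : 'X_{1..n}) : Prop :=
  forall j : 'I_n, (m j <= 1)%N.

Definition mvars (n : nat) (m : 'X_{1..n}) : {set 'I_n} :=
  [set j | m j != 0%N].

Definition facet_ideal (k : fieldType) (n : nat) (K : scomplex 'I_n)
    (f : {mpoly k[n]}) : Prop :=
  exists c : {set 'I_n} -> {mpoly k[n]},
    f = \sum_(F in facets K) c F * \prod_(j in F) 'X_j.
Arguments facet_ideal k {n} K f.

(* Minimal multigraded free resolution of S/I, where S = k[x_1, ..., x_n]:    *)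
(*   ... -> S^(rk 2) -> S^(rk 1) -> S^(rk 0) -> S/I -> 0,                      *)
(* with elements of S^(rk i) written as row vectors, maps acting on the       *)
(* right, and the p-th basis vector of S^(rk i) placed in multidegree deg p.  *)
(* The augmentation S^(rk 0) -> S/I is given by a homogeneous lift to S.      *)
(* A map has multidegree 0 when every monomial of its (p, q) entry, times     *)
(* the degree of the q-th target generator, is the degree of the p-th source  *)
(* generator.  Minimality is d(F_(i+1)) <= (x_1, ..., x_n) F_i, i.e. the      *)
(* matrix entries have no constant term.                                      *)
Record min_resolution (k : fieldType) (n : nat) (I : {mpoly k[n]} -> Prop) :=
  MinResolution {
  rk : nat -> nat;
  deg : forall i, 'I_(rk i) -> 'X_{1..n};
  aug : 'cV[{mpoly k[n]}]_(rk 0);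
  diff : forall i, 'M[{mpoly k[n]}]_(rk i.+1, rk i);
  aug_homog : forall (p : 'I_(rk 0)) (u : 'X_{1..n}),
    u \in msupp (aug p 0) -> u = deg p;
  diff_homog : forall i (p : 'I_(rk i.+1)) (q : 'I_(rk i)) (u : 'X_{1..n}),
    u \in msupp (diff i p q) -> (u + deg q)%MM = deg p;
  aug_surj : forall f : {mpoly k[n]},
    exists v : 'rV[{mpoly k[n]}]_(rk 0), I (f - (v *m aug) 0 0);
  aug_exact : forall v : 'rV[{mpoly k[n]}]_(rk 0),
    I ((v *m aug) 0 0) <-> exists w, v = w *m diff 0;
  diff_exact : forall i (v : 'rV[{mpoly k[n]}]_(rk i.+1)),
    v *m diff i = 0 <-> exists w, v = w *m diff i.+1;
  diff_minimal : forall i (p : 'I_(rk i.+1)) (q : 'I_(rk i)),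
    (diff i p q)@_0%MM = 0
}.

(* b_{i,m}(S/I), computed from a minimal resolution; such a resolution is     *)
(* unique up to isomorphism, so the value does not depend on R.               *)
Definition betti (k : fieldType) (n : nat) (I : {mpoly k[n]} -> Prop)
    (R : min_resolution I) (i : nat) (m : 'X_{1..n}) : nat :=
  #|[set p : 'I_(rk R i) | deg p == m]|.

(* Main.v *)
Require Import Defs.
From mathcomp Require Import all_boot all_order all_algebra mpoly.
From mathcomp Require Import zify.

Set Implicit Arguments.
Unset Strict Implicit.
Unset Printing Implicit Defensive.

(** The reason is that a well ordered facet cover is a cell of a Lyubeznik
    complex that no unit coefficient of the differential can cancel.

    Order the facets of Gamma so that F_1 < ... < F_i come first, and let L be
    the Lyubeznik complex of this order: its cells are the sets A of
    generators such that no generator q < t divides the lcm of the elements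
    >= t of A, for any t in A, and its differential is that of the Taylor
    complex.  It is a free resolution of S / F(Gamma): in multidegree w it is
    the augmented chain complex of the cells whose lcm divides w, and when
    some generator divides w these form a cone over the least generator
    dividing w ([boundary_cone], [cone_exact]).

    The cover A0 = {F_1, ..., F_i} is a cell of L of multidegree m, because
    the cover is minimal.  Removing a facet from A0 changes the lcm, again by
    minimality.  Adding a facet H either changes the lcm, or H is a facet of
    Gamma_m outside the cover; then F_l divides the lcm of H, F_(l+1), ...,
    F_i for some l, so that adding H to A0 does not give a cell.  Hence the
    row and the column of A0 in the differentials of L have no unit entries.

    Finally, let R be any multigraded free resolution of the same quotient.
    Lifting the identity gives chain maps f : L -> R and g : R -> L and a
    homotopy with 1 = f g + d h + h d ([comparison]).  In the diagonal entry at
    A0 the two homotopy terms vanish, all maps having multidegree 0, so some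
    basis element p of R_i has f (A0, p) g (p, A0) <> 0, which forces
    deg p = m ([degree_survives]).

    To work with matrices over the field, all variables are set to 1: a
    multigraded free resolution becomes a complex of vector spaces whose bases
    are labelled by degrees, whose differentials do not raise the label, and
    which is exact on the span of the basis elements of label <= w, for every
    w; this span is the strand of degree w of the resolution. *)

Import GRing.Theory.
Local Open Scope ring_scope.

(** * Comparison of filtered resolutions *)

Section Filtered.
Variables (k : fieldType) (D : Type) (le : rel D).
Hypothesis le_refl : reflexive le.
Hypothesis le_trans : transitive le.

Definition filtered a b (da : 'I_a -> D) (db : 'I_b -> D) (M : 'M[k]_(a, b)) :=
  forall p q, M p q != 0 -> le (db q) (da p).

Definition within b (db : 'I_b -> D) (w : D) (v : 'rV[k]_b) :=
  filtered (fun=> w) db v.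

Lemma filtered0 a b (da : 'I_a -> D) (db : 'I_b -> D) : filtered da db 0.
Proof. by move=> p q; rewrite mxE eqxx. Qed.

Lemma filtered1 a (da : 'I_a -> D) : filtered da da 1%:M.
Proof.
move=> p q; rewrite mxE; case: (p =P q) => [->|_] /=; first by move=> _.
by rewrite eqxx.
Qed.

Lemma filteredB a b (da : 'I_a -> D) (db : 'I_b -> D) M N :
  filtered da db M -> filtered da db N -> filtered da db (M - N).
Proof.
move=> fM fN p q; rewrite !mxE; case: (M p q =P 0) => [->|/eqP/fM //].
by rewrite add0r oppr_eq0 => /fN.
Qed.

Lemma filteredM a b c (da : 'I_a -> D) (db : 'I_b -> D) (dc : 'I_c -> D) M N :
  filtered da db M -> filtered db dc N -> filtered da dc (M *m N).
Proof.
move=> fM fN p q; rewrite mxE => nz.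
have [r nzr] : exists r, M p r * N r q != 0.
  apply/existsP; apply: contraNT nz => /existsPn z.
  by rewrite big1 // => r _; apply/eqP; move: (z r); rewrite negbK.
move: nzr; rewrite mulf_eq0 negb_or => /andP[/fM le1 /fN le2].
exact: le_trans le2 le1.
Qed.

Variable J : pred D.
Hypothesis J_up : forall u w, le u w -> J u -> J w.

(** The image, after all variables are set to 1, of a multigraded free
    resolution of a quotient S / I.  The predicate J says which monomials lie
    in the monomial ideal I, so that S / I is zero in the degrees of J and
    one-dimensional in the others; the last three fields say that the
    augmentation identifies the cokernel of the first differential with it. *)
Record filtered_resolution := FilteredResolution {
  frk : nat -> nat;
  fdeg : forall i, 'I_(frk i) -> D;
  faug : 'cV[k]_(frk 0);
  fdiff : forall i, 'M[k]_(frk i.+1, frk i);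
  fdiff_filtered : forall i, filtered (@fdeg i.+1) (@fdeg i) (fdiff i);
  fdiffK : forall i, fdiff i.+1 *m fdiff i = 0;
  fdiff_exact : forall i w v, within (@fdeg i.+1) w v -> v *m fdiff i = 0 ->
    exists2 y, within (@fdeg i.+2) w y & v = y *m fdiff i.+1;
  faugK : forall p, ~~ J (@fdeg 1 p) -> (fdiff 0 *m faug) p 0 = 0;
  faug_exact : forall w v, within (@fdeg 0) w v -> J w \/ (v *m faug) 0 0 = 0 ->
    exists2 y, within (@fdeg 1) w y & v = y *m fdiff 0;
  faug_surj : forall w, ~~ J w ->
    exists2 v, within (@fdeg 0) w v & (v *m faug) 0 0 = 1
}.
Arguments fdeg : clear implicits.
Arguments fdiff_filtered P i [p q] _ : rename.

Lemma rows_exist a b (Pr : 'I_a -> 'rV[k]_b -> Prop) :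
  (forall p, exists v, Pr p v) -> exists M : 'M_(a, b), forall p, Pr p (row p M).
Proof.
case/fin_all_exists=> f Pf; exists (\matrix_p f p) => p.
by rewrite rowK; apply: Pf.
Qed.

Lemma filtered_row a b (da : 'I_a -> D) (db : 'I_b -> D) (M : 'M[k]_(a, b)) :
  filtered da db M <-> forall p, within db (da p) (row p M).
Proof.
split=> fM p q; first by rewrite ord1 => r; rewrite !mxE; apply: fM.
by move=> nz; apply: (fM p 0 q); rewrite mxE.
Qed.

Lemma lift_rows a b c (da : 'I_a -> D) (db : 'I_b -> D) (M : 'M[k]_(a, c))
    (E : 'M[k]_(b, c)) :
  (forall p, exists2 y, within db (da p) y & row p M = y *m E) ->
  exists2 N, filtered da db N & M = N *m E.
Proof.
move=> ex.
have /rows_exist[N NP] : forall p, exists y,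
  within db (da p) y /\ row p M = y *m E.
  by move=> p; case: (ex p) => y; exists y.
exists N; first by apply/filtered_row => p; case: (NP p).
by apply/row_matrixP => p; rewrite row_mul; case: (NP p).
Qed.

(** The lifting property of free modules; the label of a row bounds the strand
    in which exactness is applied. *)
Lemma lift_filtered (Q : filtered_resolution) i a (da : 'I_a -> D) M :
    filtered da (fdeg Q i.+1) M -> M *m fdiff Q i = 0 ->
  exists2 N, filtered da (fdeg Q i.+2) N & M = N *m fdiff Q i.+1.
Proof.
move=> /filtered_row fM M0; apply: lift_rows => p.
by apply: fdiff_exact (fM p) _; rewrite -row_mul M0 row0.
Qed.

Lemma lift_filtered0 (Q : filtered_resolution) a (da : 'I_a -> D) M :
    filtered da (fdeg Q 0) M ->
    (forall p, ~~ J (da p) -> (M *m faug Q) p 0 = 0) ->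
  exists2 N, filtered da (fdeg Q 1) N & M = N *m fdiff Q 0.
Proof.
move=> /filtered_row fM M0; apply: lift_rows => p.
apply: faug_exact (fM p) _; case: (boolP (J (da p))) => [|nJ]; [by left|right].
by rewrite -row_mul mxE M0.
Qed.

(** Maps in homological degree 0 that lift the identity of S / I.  Nothing is
    required in the degrees of J, where S / I vanishes. *)
Definition augmented (P Q : filtered_resolution) (f : 'M[k]_(frk P 0, frk Q 0)) :=
  filtered (fdeg P 0) (fdeg Q 0) f /\
  forall p, ~~ J (fdeg P 0 p) -> (f *m faug Q) p 0 = faug P p 0.

Lemma augmented_exists P Q : exists f, @augmented P Q f.
Proof.
have /rows_exist[f fP] : forall p : 'I_(frk P 0), exists v : 'rV[k]_(frk Q 0),
    within (fdeg Q 0) (fdeg P 0 p) v /\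
    (~~ J (fdeg P 0 p) -> (v *m faug Q) 0 0 = faug P p 0).
  move=> p; case: (boolP (J (fdeg P 0 p))) => [_|/(faug_surj Q)[v vw v1]].
    by exists 0; split=> //; apply: filtered0.
  exists (faug P p 0 *: v); split=> [r q|_].
    by rewrite mxE mulf_eq0 negb_or => /andP[_]; apply: vw.
  by rewrite -scalemxAl mxE v1 mulr1.
exists f; split=> [|p /(proj2 (fP p)) <-]; last by rewrite -row_mul [RHS]mxE.
by apply/filtered_row => p; case: (fP p).
Qed.

(** An ideal being closed under multiples, a row of label outside J only
    involves basis elements of labels outside J. *)
Lemma augmentedM P Q f a (da : 'I_a -> D) (M : 'M[k]_(a, frk P 0)) p :
    @augmented P Q f -> filtered da (fdeg P 0) M -> ~~ J (da p) ->
  (M *m f *m faug Q) p 0 = (M *m faug P) p 0.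
Proof.
move=> [_ fa] fM nJ; rewrite -mulmxA [LHS]mxE [RHS]mxE; apply: eq_bigr => q _.
case: (M p q =P 0) => [->|/eqP/fM leqp]; first by rewrite !mul0r.
by rewrite fa //; apply: contra nJ; apply: J_up.
Qed.

(** The part d h of the homotopy that passes through homological degree i - 1;
    for i = 0 there is none. *)
Definition homotopy_below (P : filtered_resolution) i :
    'M[k]_(frk P i) -> Prop :=
  match i with
  | 0 => fun e => e = 0
  | j.+1 => fun e =>
    exists2 h, filtered (fdeg P j) (fdeg P j.+1) h & e = fdiff P j *m h
  end.

Lemma homotopy_belowK P i e : @homotopy_below P i e -> fdiff P i *m e = 0.
Proof.
case: i e => [|i] e /= => [->|[h _ ->]]; first by rewrite mulmx0.
by rewrite mulmxA fdiffK mul0mx.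
Qed.

(** The identity of S / I lifts to f : P -> Q and g : Q -> P, and 1 - f g is
    null-homotopic.  The maps f', g' and h in the next homological degree are
    part of the conclusion because they carry the induction. *)
Lemma comparison P Q i : exists f f' g g' e h,
  [/\ filtered (fdeg P i) (fdeg Q i) f,
      filtered (fdeg P i.+1) (fdeg Q i.+1) f',
      filtered (fdeg Q i) (fdeg P i) g &
      filtered (fdeg Q i.+1) (fdeg P i.+1) g'] /\
  [/\ filtered (fdeg P i) (fdeg P i.+1) h, @homotopy_below P i e,
      f' *m fdiff Q i = fdiff P i *m f,
      g' *m fdiff P i = fdiff Q i *m g &
      1%:M = f *m g + e + h *m fdiff P i].
Proof.
elim: i => [|i [f [f' [g [g' [e [h [[ff ff' fg fg'] [fh eP cf cg E]]]]]]]]].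
  have chain (A B : filtered_resolution) u : @augmented A B u ->
      exists2 u', filtered (fdeg A 1) (fdeg B 1) u' &
                  fdiff A 0 *m u = u' *m fdiff B 0.
    move=> uA; apply: lift_filtered0 => [|p nJ].
      by apply: filteredM (fdiff_filtered A 0) _; case: uA.
    by rewrite (augmentedM uA (fdiff_filtered A 0) nJ) faugK.
  have [f fA] := augmented_exists P Q; have [g gA] := augmented_exists Q P.
  have [[ff fa] [fg ga]] := (fA, gA).
  have [f' ff' cf] := chain _ _ _ fA; have [g' fg' cg] := chain _ _ _ gA.
  have [h fh E] : exists2 h, filtered (fdeg P 0) (fdeg P 1) h &
      1%:M - f *m g = h *m fdiff P 0.
    apply: lift_filtered0 => [|p nJ].
      by apply: filteredB (@filtered1 _ _) _; apply: filteredM ff fg.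
    rewrite mulmxBl mul1mx mxE [X in _ + X]mxE (augmentedM gA ff nJ) fa //.
    by rewrite subrr.
  exists f, f', g, g', 0, h; split=> //; split=> //.
  by rewrite addr0 -E addrC subrK.
have [f'' ff'' cf'] : exists2 N, filtered (fdeg P i.+2) (fdeg Q i.+2) N &
    fdiff P i.+1 *m f' = N *m fdiff Q i.+1.
  apply: lift_filtered; first exact: filteredM (fdiff_filtered P i.+1) ff'.
  by rewrite -mulmxA cf mulmxA fdiffK mul0mx.
have [g'' fg'' cg'] : exists2 N, filtered (fdeg Q i.+2) (fdeg P i.+2) N &
    fdiff Q i.+1 *m g' = N *m fdiff P i.+1.
  apply: lift_filtered; first exact: filteredM (fdiff_filtered Q i.+1) fg'.
  by rewrite -mulmxA cg mulmxA fdiffK mul0mx.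
(* This difference is killed by the differential because 1 - f g is a chain
   map and e is itself of the form d h. *)
have [h' fh' E'] : exists2 N, filtered (fdeg P i.+1) (fdeg P i.+2) N &
    1%:M - f' *m g' - fdiff P i *m h = N *m fdiff P i.+1.
  apply: lift_filtered.
    apply: filteredB; last exact: filteredM (fdiff_filtered P i) fh.
    by apply: filteredB (@filtered1 _ _) _; apply: filteredM ff' fg'.
  have := congr1 (mulmx (fdiff P i)) E.
  rewrite mulmx1 !mulmxDr (homotopy_belowK eP) addr0 => E1.
  rewrite !mulmxBl mul1mx -!mulmxA cg [f' *m _]mulmxA cf -mulmxA.
  by rewrite [X in X - _ - _]E1 addrAC addrK subrr.
exists f', f'', g', g'', (fdiff P i *m h), h'; split=> //; split=> //.
- by exists h.
- by rewrite -E' -[X in _ = _ + X]addrA -opprD [RHS]addrC subrK.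
Qed.

(** A nonzero entry of a multigraded differential is a scalar times a monomial,
    and that monomial is 1 exactly when the labels of its row and of its column
    agree. *)
Definition no_unit_in_row (P : filtered_resolution) i : 'I_(frk P i) -> Prop :=
  match i with
  | 0 => fun=> True
  | j.+1 => fun a =>
    forall b, fdiff P j a b != 0 -> fdeg P j b <> fdeg P j.+1 a
  end.

Definition no_unit_in_column (P : filtered_resolution) i (a : 'I_(frk P i)) :=
  forall b, fdiff P i b a != 0 -> fdeg P i.+1 b <> fdeg P i a.

Lemma homotopy_below_diag (P : filtered_resolution) i (a : 'I_(frk P i)) e :
  antisymmetric le -> no_unit_in_row a -> homotopy_below e -> e a a = 0.
Proof.
move=> le_anti; case: i a e => [|j] a e /= row => [->|]; first by rewrite mxE.
case=> h fh ->; rewrite mxE big1 // => b _; apply/eqP; apply: contraT.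
rewrite mulf_eq0 negb_or => /andP[nzb /fh leb]; case: (row b nzb).
by apply: le_anti; rewrite leb (fdiff_filtered _ _ nzb).
Qed.

(** The generator a gives a nonzero class in Tor_i(S / I, k): it is a cycle by
    the condition on its row and not a boundary by that on its column.  Any
    other resolution must then have a generator of this degree. *)
Theorem degree_survives (P Q : filtered_resolution) i (a : 'I_(frk P i)) :
    antisymmetric le -> no_unit_in_row a -> no_unit_in_column a ->
  exists p : 'I_(frk Q i), fdeg Q i p = fdeg P i a.
Proof.
move=> le_anti row col.
have [f [f' [g [g' [e [h [[ff _ fg _] [fh eP _ _ E]]]]]]]] := comparison P Q i.
have hd0 : (h *m fdiff P i) a a = 0.
  rewrite mxE big1 // => b _; apply/eqP; apply: contraT.
  rewrite mulf_eq0 negb_or => /andP[/fh leb nzb]; case: (col b nzb).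
  by apply: le_anti; rewrite leb (fdiff_filtered _ _ nzb).
have fg1 : (f *m g) a a = 1.
  move/matrixP/(_ a a): E.
  rewrite mxE eqxx [RHS]mxE hd0 addr0 [RHS]mxE.
  by rewrite (homotopy_below_diag le_anti row eP) addr0 => <-.
have [p nzp] : exists p, f a p * g p a != 0.
  apply/existsP; apply: contraT => /existsPn z; rewrite -(oner_eq0 k) -fg1 mxE.
  by rewrite big1 // => p _; apply/eqP; move: (z p); rewrite negbK.
exists p; move: nzp; rewrite mulf_eq0 negb_or => /andP[/ff le1 /fg le2].
by apply: le_anti; rewrite le1 le2.
Qed.
End Filtered.

(** * The simplicial chain complex and cones *)

Section Boundary.
Variables (k : fieldType) (N : nat).
Implicit Types (x z q : 'I_N) (A B : {set 'I_N}) (c : {set 'I_N} -> k).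

Definition vsign x B : k := (-1) ^+ #|[set y in B | (y < x)%N]|.

(** The simplicial boundary, read on coefficients: the cells having B as a face
    of codimension 1 are the x |: B with x outside B. *)
Definition boundary c B : k := \sum_(x | x \notin B) vsign x B * c (x |: B).

Lemma vsign_lt x z B : x \notin B -> (x < z)%N ->
  vsign z (x |: B) = - vsign z B.
Proof.
move=> xB ltxz; rewrite /vsign.
have -> : [set y in x |: B | (y < z)%N] = x |: [set y in B | (y < z)%N].
  by apply/setP=> y; rewrite !inE; case: eqP => // ->; rewrite ltxz.
by rewrite cardsU1 inE (negPf xB) exprS mulN1r.
Qed.

Lemma vsign_ge x z B : (z <= x)%N -> vsign z (x |: B) = vsign z B.
Proof.
move=> lezx; rewrite /vsign; congr (_ ^+ #|pred_of_set _|); apply/setP=> y.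
by rewrite !inE; case: eqP => //= ->; rewrite ltnNge lezx andbF.
Qed.

(** Antisymmetry alone would only give that twice the sum is 0; the vanishing on
    the diagonal makes the statement hold in characteristic 2 as well. *)
Lemma sum_antisymmetric (F : 'I_N -> 'I_N -> k) :
    (forall x, F x x = 0) -> (forall x z, (x < z)%N -> F x z = - F z x) ->
  \sum_x \sum_z F x z = 0.
Proof.
move=> F0 Fa; pose G x z := if (z < x)%N then F x z else 0.
transitivity (\sum_x \sum_z (G x z - G z x)).
  apply: eq_bigr => x _; apply: eq_bigr => z _; rewrite /G.
  case: (ltngtP z x) => [_|/Fa ->|/val_inj ->]; last by rewrite F0 subrr.
    by rewrite subr0.
  by rewrite sub0r.
under eq_bigr do rewrite sumrB.
by rewrite sumrB [X in _ - X]exchange_big subrr.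
Qed.

Lemma boundaryK c B : boundary (boundary c) B = 0.
Proof.
pose F x z := if (x \notin B) && (z \notin x |: B) then
  vsign x B * (vsign z (x |: B) * c (z |: (x |: B))) else 0.
transitivity (\sum_x \sum_z F x z).
  rewrite /boundary big_mkcond; apply: eq_bigr => x _; rewrite /F.
  case: ifP => xB /=; last by rewrite big1.
  by rewrite mulr_sumr big_mkcond.
apply: sum_antisymmetric => [x|x z ltxz]; rewrite /F !inE ?eqxx ?andbF //.
have neq : (x == z) = false by apply/eqP => e; rewrite e ltnn in ltxz.
rewrite [z == x]eq_sym neq /=; case xB: (x \in B) => /=; first by rewrite andbF oppr0.
case: (z \in B) => /=; first by rewrite oppr0.
rewrite vsign_lt ?xB // vsign_ge 1?ltnW // setUCA.
by rewrite mulNr mulrN; congr (- _); rewrite mulrCA.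
Qed.

Definition cone q c A : k := if q \in A then c (A :\ q) else 0.

(** A cycle is the boundary of the cone over it.  Taking the apex q below all
    vertices makes the sign of q equal to 1 in every cell, and makes the signs
    of the other vertices change when q is added. *)
Lemma boundary_cone q c B :
    (forall A, c A != 0 -> forall x, x \in A -> (q <= x)%N) ->
    (forall A, boundary c A = 0) ->
  boundary (cone q c) B = c B.
Proof.
move=> cq c0; rewrite {1}/boundary /cone.
have sq A : vsign q A * c A = c A.
  case: (c A =P 0) => [->|/eqP/cq leq]; first by rewrite mulr0.
  rewrite /vsign (_ : [set _ in _ | _] = set0) ?cards0 ?mul1r //.
  apply/setP=> x; rewrite !inE; apply/negP => /andP[/leq]; rewrite leqNgt => H.
  by rewrite (negPf H).
(* A cell without q is a face of cone cells only through its own cone; for a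
   cell B with q, the cells around B and those around B without q match, and
   the cycle condition at B without q gives the value at B. *)
case: (boolP (q \in B)) => qB; last first.
  rewrite (bigD1 q) //= setU11 setU1K // sq big1 ?addr0 // => x /andP[_ neq].
  by rewrite !inE (negPf qB) eq_sym (negPf neq) mulr0.
have := c0 (B :\ q); rewrite /boundary (bigD1 q) /= ?setD11 // setD1K //.
have -> : vsign q (B :\ q) = vsign q B.
  by rewrite -{2}(setD1K qB) vsign_ge.
rewrite sq => /eqP; rewrite addr_eq0 => /eqP ->; rewrite -sumrN.
apply: eq_big => [x|x xB].
  by rewrite !inE; case: eqP => [->|_] /=; rewrite ?qB ?andbT.
have neq : x != q by apply: contraNneq xB => ->.
rewrite !inE qB orbT setDUl (_ : [set x] :\ q = [set x]); last first.
  by apply/setP=> y; rewrite !inE; case: eqP => // ->; rewrite eq_sym (negPf neq).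
have [->|/cq leq] := eqVneq (c (x |: B :\ q)) 0; first by rewrite !mulr0 oppr0.
have leqx := leq x (setU11 _ _); rewrite -mulNr -{1}(setD1K qB) vsign_lt //.
  by rewrite setD11.
by rewrite ltn_neqAle leqx andbT; apply: contra neq => /eqP/val_inj->.
Qed.
End Boundary.

(** * The Lyubeznik resolution *)

Section Lyubeznik.
Variables (k : fieldType) (D : Type) (le : rel D).
Hypothesis le_refl : reflexive le.
Hypothesis le_trans : transitive le.
Variables (N : nat) (gen : 'I_N -> D) (lcm : {set 'I_N} -> D).
Hypothesis lcmP : forall A w, le (lcm A) w = [forall j in A, le (gen j) w].
Implicit Types (x q t : 'I_N) (A B : {set 'I_N}).

Definition tail A t := [set s in A | (t <= s)%N].

Definition admissible A :=
  [forall t in A, forall q : 'I_N, (q < t)%N ==> ~~ le (gen q) (lcm (tail A t))].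

Definition multiple : pred D := fun w => [exists j, le (gen j) w].

Lemma multiple_up u w : le u w -> multiple u -> multiple w.
Proof.
by move=> leuw /existsP[j lej]; apply/existsP; exists j; apply: le_trans lej leuw.
Qed.

Lemma gen_le_lcm j A : j \in A -> le (gen j) (lcm A).
Proof. by have := le_refl (lcm A); rewrite lcmP => /forall_inP; apply. Qed.

Lemma lcm_sub A B : A \subset B -> le (lcm A) (lcm B).
Proof.
by move=> /subsetP sAB; rewrite lcmP; apply/forall_inP=> j /sAB/gen_le_lcm.
Qed.

Lemma admissible_sub A B : B \subset A -> admissible A -> admissible B.
Proof.
move=> sBA /forall_inP adA; apply/forall_inP=> t tB; apply/forallP=> q.
apply/implyP=> ltqt; have := forallP (adA t (subsetP sBA t tB)) q.
rewrite ltqt; apply: contra => leq; apply: le_trans leq _; apply: lcm_sub.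
by apply/subsetP=> s; rewrite !inE => /andP[/(subsetP sBA)-> ->].
Qed.

Definition least_divisor q w :=
  le (gen q) w /\ forall j, le (gen j) w -> (q <= j)%N.

Lemma least_divisor_exists w : multiple w -> exists q, least_divisor q w.
Proof.
case/existsP=> j lej.
by case: (@arg_minnP _ j (fun i => le (gen i) w) (@nat_of_ord N) lej) => q; exists q.
Qed.

(** Adding the least generator q dividing w creates no new obstruction: a
    generator below q dividing a tail would be a smaller divisor of w, and the
    tails starting above q are unchanged. *)
Lemma admissible_cone q w A : least_divisor q w ->
  admissible A -> le (lcm A) w -> admissible (q |: A).
Proof.
move=> [leq qmin] adA leA.
have leqA : le (lcm (q |: A)) w.
  rewrite lcmP; apply/forall_inP=> j /setU1P[-> //|]; apply/forall_inP: j.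
  by rewrite -lcmP.
apply/forall_inP=> t tA; apply/forallP=> r; apply/implyP=> ltrt.
have [eqt|neqt] := eqVneq t q.
  apply: contraL ltrt => ler; rewrite -leqNgt eqt; apply: qmin.
  apply: le_trans leqA; apply: le_trans ler _; apply: lcm_sub.
  by apply/subsetP=> s; rewrite inE => /andP[].
have {}tA : t \in A by move: tA; rewrite !inE (negPf neqt).
have leqt : (q <= t)%N.
  by apply: qmin; apply: le_trans leA; apply: gen_le_lcm.
have -> : tail (q |: A) t = tail A t.
  apply/setP=> s; rewrite !inE; case: eqP => //= ->.
  by rewrite leqNgt ltn_neqAle leqt eq_sym neqt andbF.
by have := forallP (forall_inP adA t tA) r; rewrite ltrt.
Qed.

Definition cells i : {set {set 'I_N}} := [set A | admissible A & #|A| == i].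

(** Row vectors are extended by 0 to functions on all sets of generators, so
    that boundaries are computed without reference to the enumeration of cells. *)
Definition chain i (v : 'rV[k]_#|cells i|) A : k :=
  \sum_(a | enum_val a == A) v 0 a.

Lemma chain_enum_val i v a : @chain i v (enum_val a) = v 0 a.
Proof.
rewrite /chain (big_pred1 a) // => b; exact/(inj_eq enum_val_inj).
Qed.

Lemma chain_nonzero i v A : @chain i v A != 0 ->
  exists2 a, A = enum_val a & v 0 a != 0.
Proof.
case: (boolP (A \in cells i)) => [AC|nAC]; last first.
  rewrite /chain big1 ?eqxx // => a /eqP eA.
  by rewrite -eA enum_valP in nAC.
by rewrite -(enum_rankK_in AC AC) chain_enum_val; eexists.
Qed.

Lemma chain_row i c A : (c A != 0 -> A \in cells i) ->
  chain (\row_(a < #|cells i|) c (enum_val a)) A = c A.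
Proof.
move=> cC; case: (boolP (A \in cells i)) => [AC|nAC].
  by rewrite -[in LHS](enum_rankK_in AC AC) chain_enum_val mxE enum_rankK_in.
have /eqP -> : c A == 0 by apply: contraR nAC.
by apply/eqP; apply: contraR nAC => /chain_nonzero[a -> _]; apply: enum_valP.
Qed.

Definition lyubeznik_diff i : 'M[k]_(#|cells i.+1|, #|cells i|) :=
  \matrix_(a < #|cells i.+1|, b < #|cells i|)
     \sum_(x | (x \notin enum_val b) && (x |: enum_val b == enum_val a))
     vsign k x (enum_val b).

(** Closure of the cells under subsets is what makes the boundary of a chain of
    cells vanish outside the cells. *)
Lemma chain_diff i (v : 'rV_#|cells i.+1|) A :
  chain (v *m lyubeznik_diff i) A = boundary (chain v) A.
Proof.
have E b : (v *m lyubeznik_diff i) 0 b = boundary (chain v) (enum_val b).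
  rewrite mxE /boundary; under eq_bigr do rewrite mxE big_mkcondr mulr_sumr.
  rewrite exchange_big; apply: eq_bigr => x xb; rewrite /chain mulr_sumr.
  rewrite [RHS]big_mkcond; apply: eq_bigr => a _; rewrite eq_sym.
  by case: eqP => _; rewrite ?mulr0 // mulrC.
rewrite (_ : _ *m _ = \row_a boundary (chain v) (enum_val a)); last first.
  by apply/rowP=> b; rewrite E mxE.
apply: chain_row; apply: contraR => nAC; rewrite /boundary big1 // => x xA.
have [->|/chain_nonzero[a eA _]] := eqVneq (chain v (x |: A)) 0.
  by rewrite mulr0.
have := enum_valP a; rewrite -eA inE cardsU1 xA add1n eqSS => /andP[ad sz].
by case/negP: nAC; rewrite inE sz (admissible_sub (subsetUr _ _) ad).
Qed.

Definition lyubeznik_deg i (a : 'I_#|cells i|) := lcm (enum_val a).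

Lemma lyubeznik_diff_nonzero i a b : lyubeznik_diff i a b != 0 ->
  exists2 x, x \notin enum_val b & enum_val a = x |: enum_val b.
Proof.
rewrite mxE => nz.
have [x /andP[xb /eqP e]] : exists x : 'I_N,
    (x \notin enum_val b) && (x |: enum_val b == enum_val a).
  apply/existsP; apply: contraNT nz => /existsPn z.
  rewrite big_pred0 // => x. exact: (negbTE (z x)).
by exists x.
Qed.

Lemma lyubeznik_diff_filtered i :
  filtered le (@lyubeznik_deg i.+1) (@lyubeznik_deg i) (lyubeznik_diff i).
Proof.
move=> a b /lyubeznik_diff_nonzero[x _ e].
by rewrite /lyubeznik_deg e lcm_sub ?subsetUr.
Qed.

Lemma lyubeznik_diffK i : lyubeznik_diff i.+1 *m lyubeznik_diff i = 0.
Proof.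
apply/row_matrixP=> a; rewrite row0; apply/rowP=> b.
rewrite -chain_enum_val rowE mulmxA chain_diff [RHS]mxE.
rewrite -[RHS](boundaryK (chain (delta_mx 0 a)) (enum_val b)).
by apply: eq_bigr => x _; rewrite chain_diff.
Qed.

(** In a degree w of the ideal, every cycle is the boundary of its cone over the
    least generator dividing w. *)
Lemma cone_exact i w (v : 'rV_#|cells i|) :
    within le (@lyubeznik_deg i) w v -> multiple w ->
    (forall A, boundary (chain v) A = 0) ->
  exists2 y, within le (@lyubeznik_deg i.+1) w y & v = y *m lyubeznik_diff i.
Proof.
move=> vw /least_divisor_exists[q qw] v0.
have suppv A : chain v A != 0 -> A \in cells i /\ le (lcm A) w.
  by case/chain_nonzero=> a -> nz; rewrite enum_valP; split=> //; apply: vw nz.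
have supp A : cone q (chain v) A != 0 -> A \in cells i.+1 /\ le (lcm A) w.
  rewrite /cone; case: ifP => [qA /suppv[]|_]; last by rewrite eqxx.
  rewrite inE => /andP[ad sz] leA; rewrite inE (cardsD1 q) qA add1n eqSS sz andbT.
  rewrite -{1 2}(setD1K qA) (admissible_cone qw) //; split=> //.
  rewrite lcmP; apply/forall_inP=> j /setU1P[->|]; first by case: qw.
  by apply/forall_inP: j; rewrite -lcmP.
exists (\row_a cone q (chain v) (enum_val a)).
  by move=> r a; rewrite mxE => /supp[].
apply/rowP=> b; rewrite -!chain_enum_val chain_diff.
transitivity (boundary (cone q (chain v)) (enum_val b)).
  rewrite boundary_cone // => A /suppv[_ leA] x xA; case: qw => _; apply.
  exact: le_trans (gen_le_lcm xA) leA.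
apply: eq_bigr => x _; congr (_ * _); rewrite chain_row //.
by case/supp.
Qed.

Lemma chain0 i A : chain (0 : 'rV_#|cells i|) A = 0.
Proof. by rewrite /chain big1 // => a _; rewrite mxE. Qed.

Lemma lyubeznik_exact i w v :
    within le (@lyubeznik_deg i.+1) w v -> v *m lyubeznik_diff i = 0 ->
  exists2 y, within le (@lyubeznik_deg i.+2) w y & v = y *m lyubeznik_diff i.+1.
Proof.
move=> vw v0; case: (boolP (multiple w)) => [mw|nw].
  by apply: cone_exact vw mw _ => A; rewrite -chain_diff v0 chain0.
exists 0; first exact: filtered0.
rewrite mul0mx; apply/rowP=> a; rewrite mxE; apply/eqP; apply: contraR nw => nz.
have := enum_valP a; rewrite inE => /andP[_ sz].
have [x xa] : exists x, x \in enum_val a by apply/card_gt0P; rewrite (eqP sz).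
apply/existsP; exists x; apply: le_trans (gen_le_lcm xa) _; exact: vw nz.
Qed.

Lemma cells0P A : (A \in cells 0) = (A == set0).
Proof.
rewrite inE cards_eq0 andbC; case: eqP => //= ->.
by apply/forall_inP=> t; rewrite inE.
Qed.

Definition lyubeznik_aug : 'cV[k]_#|cells 0| := const_mx 1.

Lemma mul_lyubeznik_aug v : (v *m lyubeznik_aug) 0 0 = chain v set0.
Proof.
rewrite mxE /chain; apply: eq_big => [a|a _]; last by rewrite mxE mulr1.
by have := enum_valP a; rewrite cells0P => ->.
Qed.

Lemma lyubeznik_aug_exact w v : within le (@lyubeznik_deg 0) w v ->
    multiple w \/ (v *m lyubeznik_aug) 0 0 = 0 ->
  exists2 y, within le (@lyubeznik_deg 1) w y & v = y *m lyubeznik_diff 0.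
Proof.
move=> vw [mw|v0].
  apply: cone_exact => // A; rewrite /boundary big1 // => x _.
  have [->|/chain_nonzero[a eA _]] := eqVneq (chain v (x |: A)) 0.
  by rewrite mulr0.
  have := enum_valP a; rewrite -eA cells0P => /eqP e.
  by have := setU11 x A; rewrite e inE.
exists 0; first exact: filtered0.
rewrite mul0mx; apply/rowP=> a; rewrite mxE -chain_enum_val.
have := enum_valP a; rewrite cells0P => /eqP ->.
by rewrite -mul_lyubeznik_aug.
Qed.

Lemma lyubeznik_augK p : ~~ multiple (@lyubeznik_deg 1 p) ->
  (lyubeznik_diff 0 *m lyubeznik_aug) p 0 = 0.
Proof.
case/existsP; have := enum_valP p; rewrite inE => /andP[_ sz].
have [x xa] : exists x, x \in enum_val p by apply/card_gt0P; rewrite (eqP sz).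
by exists x; apply: gen_le_lcm.
Qed.

Lemma lyubeznik_aug_surj w : ~~ multiple w ->
  exists2 v, within le (@lyubeznik_deg 0) w v & (v *m lyubeznik_aug) 0 0 = 1.
Proof.
move=> _; exists (const_mx 1) => [r a _|].
  have := enum_valP a; rewrite cells0P /lyubeznik_deg => /eqP ->.
  by rewrite lcmP; apply/forall_inP=> j; rewrite inE.
have C0 : set0 \in cells 0 by rewrite cells0P.
rewrite mul_lyubeznik_aug -(enum_rankK_in C0 C0) chain_enum_val mxE //.
Qed.

Definition lyubeznik : filtered_resolution k le multiple :=
  FilteredResolution lyubeznik_diff_filtered lyubeznik_diffK lyubeznik_exact
    lyubeznik_augK lyubeznik_aug_exact lyubeznik_aug_surj.

Lemma lyubeznik_no_unit_in_row i (a : 'I_(frk lyubeznik i)) :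
    (forall x, x \in enum_val a -> lcm (enum_val a :\ x) <> lcm (enum_val a)) ->
  no_unit_in_row a.
Proof.
case: i a => //= i a nolcm b /lyubeznik_diff_nonzero[x xb ea].
have := nolcm x; rewrite /lyubeznik_deg ea setU11 setU1K //; exact.
Qed.

Lemma lyubeznik_no_unit_in_column i (a : 'I_(frk lyubeznik i)) :
    (forall x, x \notin enum_val a -> admissible (x |: enum_val a) ->
       lcm (x |: enum_val a) <> lcm (enum_val a)) ->
  no_unit_in_column a.
Proof.
move=> nolcm b /lyubeznik_diff_nonzero[x xa eb] /=.
rewrite /lyubeznik_deg eb; apply: nolcm => //; rewrite -eb.
by have := enum_valP b; rewrite inE => /andP[].
Qed.
End Lyubeznik.

(** * Strands of a multigraded resolution *)

Section Dehomogenize.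
Variables (k : fieldType) (n : nat).
Implicit Types (u w : 'X_{1..n}).
Local Notation S := {mpoly k[n]}.
Local Notation lem := (@lem n).

Lemma mcoeffMX_le (f : S) u w :
  (f * 'X_[u])@_w = if (u <= w)%MM then f@_(w - u) else 0.
Proof.
case: ifP => [leuw|nle]; first by rewrite -{1}(submK leuw) addmC mcoeffMX.
apply/eqP; apply: contraFT nle; rewrite -mcoeff_msupp (perm_mem (msuppMX f u)).
by case/mapP=> v _ ->; apply: lem_addr.
Qed.

Definition homogeneous_matrix a b (da : 'I_a -> 'X_{1..n})
    (db : 'I_b -> 'X_{1..n}) (M : 'M[S]_(a, b)) :=
  forall p q u, u \in msupp (M p q) -> (u + db q)%MM = da p.

Definition dehomogenize a b (da : 'I_a -> 'X_{1..n})
    (db : 'I_b -> 'X_{1..n}) (M : 'M[S]_(a, b)) : 'M[k]_(a, b) :=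
  \matrix_(p, q) (M p q)@_(da p - db q).

(** The degree w component of a vector of polynomials, written in the basis
    formed by the monomial multiples of the generators. *)
Definition strand b (db : 'I_b -> 'X_{1..n}) w (v : 'rV[S]_b) : 'rV[k]_b :=
  \row_q if (db q <= w)%MM then (v 0 q)@_(w - db q) else 0.

Definition homogenize b (db : 'I_b -> 'X_{1..n}) w (v : 'rV[k]_b) : 'rV[S]_b :=
  \row_q (v 0 q *: 'X_[w - db q]).

Lemma strand_within b (db : 'I_b -> 'X_{1..n}) w v :
  within lem db w (strand db w v).
Proof. by move=> r q; rewrite mxE; case: ifP; rewrite ?eqxx. Qed.

Lemma homogenizeK b (db : 'I_b -> 'X_{1..n}) w v :
  within lem db w v -> strand db w (homogenize db w v) = v.
Proof.
move=> vw; apply/rowP=> q; rewrite !mxE mcoeffZ mcoeffX eqxx mulr1.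
by case: ifP => // nle; apply/esym/eqP; apply: contraFT nle; apply: vw.
Qed.

Lemma strand0 b (db : 'I_b -> 'X_{1..n}) w : strand db w 0 = 0.
Proof. by apply/rowP=> q; rewrite !mxE mcoeff0 if_same. Qed.

Section HomogeneousMatrix.
Variables (a b : nat) (da : 'I_a -> 'X_{1..n}) (db : 'I_b -> 'X_{1..n}).
Variable M : 'M[S]_(a, b).
Hypothesis homM : homogeneous_matrix da db M.

Lemma dehomogenize_filtered : filtered lem da db (dehomogenize da db M).
Proof.
by move=> p q; rewrite mxE -mcoeff_msupp => /homM <-; apply: lem_addl.
Qed.

(** A homogeneous matrix has at most one monomial in each entry. *)
Lemma dehomogenizeE p q :
  M p q = dehomogenize da db M p q *: 'X_[da p - db q].
Proof.
apply/mpolyP=> u; rewrite mcoeffZ mcoeffX mxE.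
case: eqP => [<-|neq]; first by rewrite mulr1.
rewrite mulr0; apply/eqP; apply: contra_notT neq; rewrite -mcoeff_msupp.
by move/homM=> <-; rewrite addmK.
Qed.

(** Setting the variables to 1 loses nothing: on each strand, a homogeneous
    matrix acts through its matrix of coefficients. *)
Lemma strandM w v :
  strand db w (v *m M) = strand da w v *m dehomogenize da db M.
Proof.
apply/rowP=> q; rewrite [LHS]mxE [RHS]mxE.
transitivity (\sum_p if (db q <= w)%MM then (v 0 p * M p q)@_(w - db q) else 0).
  by rewrite mxE raddf_sum; case: ifP => // _; rewrite big1.
apply: eq_bigr => p _; rewrite [strand _ _ _ _ _]mxE dehomogenizeE.
have [->|nz] := eqVneq (dehomogenize da db M p q) 0.
  by rewrite scale0r !mulr0 mcoeff0 if_same.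
have leqp := dehomogenize_filtered nz.
rewrite -scalerAr mcoeffZ mcoeffMX_le mulrC.
have [lepw|nlepw] := boolP (da p <= w)%MM.
  have leqw := lepm_trans leqp lepw; rewrite leqw.
  rewrite (_ : (_ - db q <= _)%MM = true).
    congr (_@_ _ * _); apply/mnmP=> j; rewrite !mnmE.
    have := mnm_lepP leqp j; have := mnm_lepP lepw j; lia.
  by apply/mnm_lepP=> j; rewrite !mnmE leq_sub2r // (mnm_lepP lepw).
rewrite mul0r; case: ifP => // leqw; case: ifP => [le2|_]; last by rewrite mul0r.
case/negP: nlepw; apply/mnm_lepP=> j.
have := mnm_lepP leqp j; have := mnm_lepP leqw j; have := mnm_lepP le2 j.
rewrite !mnmE; lia.
Qed.

Lemma homogenizeM w v : within lem da w v ->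
  homogenize da w v *m M = homogenize db w (v *m dehomogenize da db M).
Proof.
move=> vw; apply/rowP=> q; rewrite [LHS]mxE [RHS]mxE [X in X *: _]mxE scaler_suml.
apply: eq_bigr => p _; rewrite mxE dehomogenizeE.
have [->|nz] := eqVneq (dehomogenize da db M p q) 0.
  by rewrite !scale0r mulr0 mulr0 scale0r.
have [->|nzv] := eqVneq (v 0 p) 0; first by rewrite scale0r !mul0r scale0r.
have lepw := vw _ _ nzv; have leqp := dehomogenize_filtered nz.
rewrite -scalerAl -scalerAr scalerA -mpolyXD; congr (_ *: 'X_[_]).
apply/mnmP=> j; rewrite !mnmE.
have := mnm_lepP leqp j; have := mnm_lepP lepw j; lia.
Qed.
End HomogeneousMatrix.

Variables (I : S -> Prop) (J : pred 'X_{1..n}).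
Hypothesis I_monomial : forall c w, J w -> I (c *: 'X_[w]).
Hypothesis I_coef : forall f w, I f -> f@_w != 0 -> J w.
Variable R : min_resolution I.

(* The augmentation is a homogeneous matrix with target S, whose generator has
   degree 0. *)
Let rdeg i : 'I_(rk R i) -> 'X_{1..n} := @deg k n I R i.
Let sdiff i := dehomogenize (@rdeg i.+1) (@rdeg i) (diff R i).
Let saug := dehomogenize (@rdeg 0) (fun=> 0%MM) (aug R).

Let diffH i : homogeneous_matrix (@rdeg i.+1) (@rdeg i) (diff R i).
Proof. by move=> p q u; apply: diff_homog. Qed.

Let augH : homogeneous_matrix (@rdeg 0) (fun=> 0%MM) (aug R).
Proof. by move=> p q u; rewrite ord1 addm0; apply: aug_homog. Qed.

Let coef_aug v w : ((v *m aug R) 0 0)@_w = (strand (@rdeg 0) w v *m saug) 0 0.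
Proof.
rewrite /saug -(strandM augH) [RHS]mxE subm0 ifT //.
by apply/mnm_lepP=> j; rewrite mnmE.
Qed.

Let delta_within i p : within lem (@rdeg i) (rdeg p) (delta_mx 0 p : 'rV[k]_(rk R i)).
Proof.
move=> r q; rewrite mxE; case: (q =P p) => [-> _|_]; first exact: lepm_refl.
by rewrite andbF eqxx.
Qed.

Lemma strand_diff_filtered i : filtered lem (@rdeg i.+1) (@rdeg i) (sdiff i).
Proof. exact: dehomogenize_filtered (@diffH i). Qed.

Lemma strand_diffK i : sdiff i.+1 *m sdiff i = 0.
Proof.
apply/row_matrixP=> p; rewrite row0 rowE mulmxA.
rewrite -{1}(homogenizeK (@delta_within _ p)) -!strandM //.
rewrite (iffRL (diff_exact _)) ?strand0 //.
by eexists.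
Qed.

Lemma strand_diff_exact i w v :
    within lem (@rdeg i.+1) w v -> v *m sdiff i = 0 ->
  exists2 y, within lem (@rdeg i.+2) w y & v = y *m sdiff i.+1.
Proof.
move=> vw v0.
have [|y Ey] := iffLR (diff_exact (homogenize (@rdeg i.+1) w v)).
  rewrite (homogenizeM (@diffH i) vw) [_ *m _]v0.
  by apply/rowP=> q; rewrite !mxE scale0r.
exists (strand (@rdeg i.+2) w y); first exact: strand_within.
by rewrite -strandM // -Ey homogenizeK.
Qed.

Lemma strand_augK p : ~~ J (@rdeg 1 p) -> (sdiff 0 *m saug) p 0 = 0.
Proof.
move=> nJ; have -> : (sdiff 0 *m saug) p 0 =
    ((delta_mx 0 p : 'rV[k]_(rk R 1)) *m sdiff 0 *m saug) 0 0.
  by rewrite -mulmxA -rowE [RHS]mxE.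
rewrite -(homogenizeK (@delta_within _ p)) -strandM // -coef_aug.
apply/eqP; apply: contraR nJ; apply: I_coef.
by apply/aug_exact; eexists.
Qed.

Lemma strand_aug_exact w v : within lem (@rdeg 0) w v ->
    J w \/ (v *m saug) 0 0 = 0 ->
  exists2 y, within lem (@rdeg 1) w y & v = y *m sdiff 0.
Proof.
move=> vw Jv.
have [|y Ey] := iffLR (aug_exact (homogenize (@rdeg 0) w v)).
  have I0 : I 0.
    have : I (((0 : 'rV_(rk R 0)) *m aug R) 0 0).
      by apply/aug_exact; exists 0; rewrite mul0mx.
    by rewrite mul0mx mxE.
  rewrite (homogenizeM augH vw) mxE.
  by case: Jv => [Jw|->]; [rewrite subm0; apply: I_monomial|rewrite scale0r].
exists (strand (@rdeg 1) w y); first exact: strand_within.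
by rewrite -strandM // -Ey homogenizeK.
Qed.

Lemma strand_aug_surj w : ~~ J w ->
  exists2 v, within lem (@rdeg 0) w v & (v *m saug) 0 0 = 1.
Proof.
move=> nJ; have [v Iv] := aug_surj R 'X_[w].
exists (strand (@rdeg 0) w v); first exact: strand_within.
rewrite -coef_aug; apply/eqP; rewrite eq_sym -subr_eq0; apply: contraR nJ.
by move=> nz; apply: I_coef Iv _; rewrite mcoeffB mcoeffX eqxx.
Qed.

Definition strands : filtered_resolution k lem J :=
  FilteredResolution strand_diff_filtered strand_diffK strand_diff_exact
    strand_augK strand_aug_exact strand_aug_surj.
End Dehomogenize.

(** * The facet ideal *)

Section FacetIdeal.
Variables (k : fieldType) (n : nat).
Implicit Types (K : scomplex 'I_n) (U F A : {set 'I_n}) (w : 'X_{1..n}).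

Definition mset U : 'X_{1..n} := [multinom nat_of_bool (j \in U) | j < n].

Lemma mset_le U w : (mset U <= w)%MM = (U \subset mvars w).
Proof.
apply/mnm_lepP/subsetP=> [le j jU|sUw j].
  by have := le j; rewrite mnmE jU inE lt0n.
by rewrite mnmE; case: (boolP (j \in U)) => // /sUw; rewrite inE lt0n.
Qed.

Lemma mvars_mset U : mvars (mset U) = U.
Proof. by apply/setP=> j; rewrite inE mnmE eqb0 negbK. Qed.

Lemma prodX_mset F : \prod_(j in F) 'X_j = 'X_[mset F] :> {mpoly k[n]}.
Proof.
rewrite mpolyXE_id big_mkcond; apply: eq_bigr => j _.
by rewrite mnmE; case: (j \in F); rewrite ?expr1 ?expr0.
Qed.

Lemma facet_ideal_monomial K c w F : F \in facets K -> F \subset mvars w ->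
  facet_ideal k K (c *: 'X_[w]).
Proof.
rewrite -mset_le => FK leF.
exists (fun G => if G == F then c *: 'X_[w - mset F] else 0).
rewrite (bigD1 F) //= eqxx [X in _ + X]big1 => [|G /andP[_ /negPf->]].
  2: by rewrite mul0r.
by rewrite addr0 prodX_mset -scalerAl -mpolyXD submK.
Qed.

Lemma facet_ideal_coef K f w : facet_ideal k K f -> f@_w != 0 ->
  exists2 F, F \in facets K & F \subset mvars w.
Proof.
case=> c -> nz; apply/exists_inP; apply: contraNT nz => /exists_inPn none.
rewrite raddf_sum big1 // => F FK.
by rewrite /= prodX_mset mcoeffMX_le mset_le (negPf (none F FK)).
Qed.

(** The facets of K contained in A already form an antichain. *)
Lemma facets_induced K A :
  facets (induced K A) = [set F in facets K | F \subset A].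
Proof.
pose Fs := [set G in facets K | G \subset A]; apply/setP=> F.
rewrite -[RHS]/(F \in Fs) [LHS]inE.
have FsP G : G \in Fs -> G \in gen_faces Fs.
  by move=> GFs; rewrite inE; apply/exists_inP; exists G.
apply/maxsetP/idP=> /= [[] | FFs].
  rewrite inE => /exists_inP[G GFs sFG] Fmax.
  by rewrite -(Fmax G (FsP G GFs) sFG).
split=> [|G]; first exact: FsP.
rewrite inE => /exists_inP[H HFs sGH] sFG; apply/eqP.
rewrite eqEsubset sFG andbT.
have HK : H \in faces K by move: HFs; rewrite !inE => /andP[/maxsetp].
have /maxsetP[_ Fmax] : maxset [pred G | G \in faces K] F.
  by move: FFs; rewrite !inE => /andP[].
by rewrite -(Fmax H HK (subset_trans sFG sGH)).
Qed.
End FacetIdeal.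

(** * Well ordered facet covers as cells *)

Theorem corollary3p4 (k : fieldType) (n : nat) (Gamma : scomplex 'I_n)
    (hV : vertices Gamma = [set: 'I_n])
    (m : 'X_{1..n}) (hm : squarefree m)
    (hsupp : vertices (induced Gamma (mvars m)) = mvars m)
    (i : nat)
    (hcover : exists F : 'I_i -> {set 'I_n},
        well_ordered_facet_cover (induced Gamma (mvars m)) F)
    (R : min_resolution (facet_ideal k Gamma)) :
  betti R i m <> 0%N.
Proof.
case: hcover => F [Finj /minsetP[/andP[sDfac covD] Dmin] wo].
set D := [set F j | j : 'I_i] in sDfac covD Dmin wo.
set W := mvars m in hsupp sDfac covD Dmin wo *.
rewrite hsupp in covD.
have Ffac l : F l \in facets Gamma /\ F l \subset W.
  have := subsetP sDfac (F l); rewrite imset_f // facets_induced inE => /(_ isT).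
  by move/andP.
(* The order of the generators: the cover first, in its given order, then the
   other facets of Gamma. *)
pose s := [seq F l | l <- enum 'I_i] ++ enum (facets Gamma :\: D).
pose g (j : 'I_(size s)) := nth set0 s j.
have szF : size [seq F l | l <- enum 'I_i] = i by rewrite size_map size_enum_ord.
have lei : (i <= size s)%N by rewrite size_cat szF leq_addr.
pose e (l : 'I_i) := widen_ord lei l.
have ge l : g (e l) = F l.
  by rewrite /g nth_cat szF /= ltn_ord (nth_map l) ?size_enum_ord // nth_ord_enum.
pose A0 := [set j : 'I_(size s) | (j < i)%N].
have A0P j : j \in A0 -> exists l, j = e l.
  by rewrite inE => ltji; exists (Ordinal ltji); apply: val_inj.
have eA0 l : e l \in A0 by rewrite inE /= ltn_ord.
have gNA0 j : j \notin A0 -> g j \in facets Gamma :\: D.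
  rewrite inE -leqNgt => leij; rewrite -mem_enum /g nth_cat szF ltnNge leij /=.
  apply: mem_nth; rewrite -(ltn_add2l i) subnKC //.
  by rewrite (leq_trans (ltn_ord j)) // size_cat szF.
have gfac j : g j \in facets Gamma.
  case: (boolP (j \in A0)) => [/A0P[l ->]|/gNA0]; first by rewrite ge; case: (Ffac l).
  by rewrite inE => /andP[].
pose un (A : {set 'I_(size s)}) := \bigcup_(j in A) g j.
have cardA0 : #|A0| = i.
  rewrite -[RHS]card_ord -(card_imset _ (f := e)); last first.
    by move=> x y /(congr1 val) /= /val_inj.
  apply: eq_card => j; apply/idP/imsetP => [/A0P[l ->]|[l _ ->]] //.
  by exists l.
have unA0 : un A0 = W.
  apply/eqP; rewrite eqEsubset; apply/andP; split.
    by apply/bigcupsP => j /A0P[l ->]; rewrite ge; case: (Ffac l).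
  apply: subset_trans covD _; apply/bigcupsP => _ /imsetP[l _ ->].
  by rewrite -ge; apply: bigcup_sup.
(* Minimality of the cover: no proper subset of A0 has the lcm of A0. *)
have minA0 (B : {set 'I_(size s)}) : B \subset A0 -> W \subset un B -> B = A0.
  move=> sBA covB; apply/eqP; rewrite eqEcard sBA cardA0.
  have sBD : g @: B \subset D.
    apply/subsetP=> _ /imsetP[j /(subsetP sBA)/A0P[l ->] ->].
    by rewrite ge imset_f.
  have <- : #|D| = i by rewrite card_imset ?card_ord.
  rewrite -(Dmin (g @: B)) ?leq_imset_card // /facet_cover.
  by rewrite (subset_trans sBD) // hsupp cover_imset.
pose gen j := mset (g j); pose lcm A := mset (un A).
have lcmP A w : (lcm A <= w)%MM = [forall j in A, (gen j <= w)%MM].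
  rewrite mset_le; apply/bigcupsP/forall_inP => H j /H; by rewrite mset_le.
pose le := @lem n.
have le_refl : reflexive le by apply: lepm_refl.
have le_trans : transitive le by move=> v u w; apply: lepm_trans.
have le_anti : antisymmetric le.
  move=> u w /andP[/mnm_lepP le1 /mnm_lepP le2].
  by apply/mnmP=> j; apply/eqP; rewrite eqn_leq le1 le2.
have leU (j : 'I_(size s)) A : le (gen j) (lcm A) = (g j \subset un A).
  by rewrite /le mset_le mvars_mset.
(* A facet F_q dividing the lcm of later elements of the cover would be
   redundant in it. *)
have adA0 : admissible le gen lcm A0.
  apply/forall_inP=> t tA; apply/forallP=> q; apply/implyP=> ltqt.
  rewrite leU; apply/negP => sq.
  have : A0 :\ q = A0.
    apply: minA0; first exact: subsetDl.
    rewrite -unA0; apply/bigcupsP => j jA.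
    have [->|neq] := eqVneq j q; last by apply: bigcup_sup; rewrite in_setD1 neq.
    apply: subset_trans sq _; apply/bigcupsP => r; rewrite inE => /andP[rA letr].
    apply: bigcup_sup; rewrite in_setD1 rA andbT.
    by apply: contraTneq ltqt => <-; rewrite -leqNgt.
  move/setP/(_ q); rewrite !inE eqxx /=; move: tA; rewrite inE => /(ltn_trans ltqt).
  by move=> ->.
have A0C : A0 \in cells le gen lcm i by rewrite inE adA0 cardA0 /=.
pose J := multiple le gen.
have JP w : J w <-> exists2 G, G \in facets Gamma & G \subset mvars w.
  split=> [/existsP[j]|[G GK sG]]; first by rewrite /le mset_le; exists (g j).
  have Gs : G \in s.
    rewrite mem_cat mem_enum inE GK andbT orbC.
    case: (boolP (G \in D)) => //= /imsetP[l _ ->].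
    by rewrite map_f // mem_enum.
  apply/existsP; exists (Ordinal (etrans (index_mem G s) Gs)).
  by rewrite /le mset_le /g /= nth_index.
pose P := lyubeznik k le_refl le_trans lcmP.
have Imon c w : J w -> facet_ideal k Gamma (c *: 'X_[w]).
  by move=> /JP[G GK sG]; apply: facet_ideal_monomial GK sG.
have Icoef f w : facet_ideal k Gamma f -> f@_w != 0 -> J w.
  by move=> If nz; apply/JP; apply: facet_ideal_coef If nz.
pose Q := strands Imon Icoef R.
pose a : 'I_(frk P i) := enum_rank_in A0C A0.
have aE : enum_val a = A0 by rewrite enum_rankK_in.
have dega : fdeg a = m.
  rewrite /= /lyubeznik_deg aE /lcm unA0; apply/mnmP=> j; rewrite mnmE inE.
  by have := hm j; case: (m j) => [|[]].
have [p degp] : exists p : 'I_(frk Q i), fdeg p = fdeg a.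
  apply: (degree_survives le_refl le_trans (@multiple_up _ _ le_trans _ gen)) => //.
    apply: lyubeznik_no_unit_in_row => x; rewrite aE => xA /(congr1 (@mvars n)).
    rewrite !mvars_mset unA0 => e1; have := setD11 x A0.
    by rewrite (minA0 (A0 :\ x)) ?subsetDl ?e1 // xA.
  apply: lyubeznik_no_unit_in_column => z; rewrite aE => zA adz.
  move/(congr1 (@mvars n)); rewrite !mvars_mset unA0 => unz.
  (* A facet z preserving the lcm m is a facet of Gamma_m outside the cover; the
     index l given for it by the well ordering makes F_l divide the lcm of the
     tail of z |: A0 at l + 1, so z |: A0 is not a cell. *)
  have := gNA0 z zA; rewrite inE => /andP[gzD gzfac].
  have [|//|l [lti sub]] := wo (g z).
    rewrite facets_induced inE gzfac -unz; apply: bigcup_sup; exact: setU11.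
  pose t := e (Ordinal lti).
  have := forall_inP adz t (setU1r _ (eA0 _)) => /forallP/(_ (e l)).
  rewrite ltnSn leU /= => /negP; apply; rewrite ge; apply: subset_trans sub _.
  have zt : z \in tail (z |: A0) t.
    rewrite inE setU11 /=; move: zA; rewrite inE -leqNgt; apply: leq_trans.
    exact: ltnW.
  rewrite subUset (bigcup_sup _ zt) //=; apply/bigcupsP=> j ltlj.
  by rewrite -ge; apply: bigcup_sup; rewrite inE setU1r //= ltlj.
have : (0 < betti R i m)%N.
  by apply/card_gt0P; exists p; rewrite inE -dega; apply/eqP.
by case: betti.
Qed.
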